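(* Let $\alpha>0$, let $k$ be a positive integer and let $(X,d,\mu)$ be an $\alpha$-Ahlfors regular space whose $d$-balls are open sets, with triangle constant $\kappa$ and Ahlfors constants $\gamma,\Gamma$. Let $\varphi:\mathbb{R}_{\geq 0}\to\mathbb{R}_{\geq 0}$ be a nonincreasing function satisfying $0<s(\varphi)=\int_0^\infty\varphi(t)t^{k\alpha-1}\,dt<\infty$. Then there exists a constant $C$ depending only on $\kappa$, $\gamma$, $\Gamma$, $\alpha$ and $k$ such that $$\Phi^*(f_1,\ldots,f_k)(x)\le C\,\mathcal{M}(f_1,\ldots,f_k)(x)$$ for all measurable functions $f_1,\ldots,f_k$ on $X$ and every $x\in X$.
   Context: A quasi-metric on a set $X$ is a symmetric function $d:X\times X\to\mathbb{R}_{\ge0}$ with $d(x,y)=0$ if and only if $x=y$, for which there is a constant $\kappa\ge1$ (the triangle constant) with $d(x,z)\le\kappa(d(x,y)+d(y,z))$ for all $x,y,z\in X$. Balls are $B_d(x,r)=\{y\in X:d(x,y)<r\}$, $r>0$. The topology on $X$ is the one induced by $d$ (a set is open if it contains a ball centered at each of its points). $\mu$ is a positive measure on a $\sigma$-algebra containing the $d$-balls, and $\mu^k$ is the product measure on $X^k$. $(X,d,\mu)$ is $\alpha$-Ahlfors regular with constants $0<\gamma\le\Gamma<\infty$ if $\gamma r^\alpha\le\mu(B_d(x,r))\le\Gamma r^\alpha$ for every $x\in X$ and every $r>0$. The hypermetric of order $k+1$ on $X$ induced by $d$ is $\rho:X^{k+1}\to\mathbb{R}_{\ge0}$, $\rho(x_0,x_1,\ldots,x_k)=\inf_{u\in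 X}\max_{0\le i\le k}d(x_i,u)$. For $x\in X$, $r>0$ set $E(x,r)=\{(x_1,\ldots,x_k)\in X^k:\rho(x,x_1,\ldots,x_k)<r\}$. For $\varepsilon>0$, $$\Phi_\varepsilon(x,x_1,\ldots,x_k)=\frac{1}{J(x,\varepsilon)}\varphi\left(\frac{\rho(x,x_1,\ldots,x_k)}{\varepsilon}\right),\qquad J(x,\varepsilon)=\int_{X^k}\varphi\left(\frac{\rho(x,x_1,\ldots,x_k)}{\varepsilon}\right)d\mu^k(x_1,\ldots,x_k).$$ The maximal operators are $$\Phi^*(f_1,\ldots,f_k)(x)=\sup_{\varepsilon>0}\int_{X^k}\Phi_\varepsilon(x,x_1,\ldots,x_k)\prod_{i=1}^k|f_i(x_i)|\,d\mu^k(x_1,\ldots,x_k),$$ $$\mathcal{M}(f_1,\ldots,f_k)(x)=\sup_{r>0}\frac{1}{\mu^k(E(x,r))}\int_{E(x,r)}\prod_{i=1}^k|f_i(x_i)|\,d\mu^k(x_1,\ldots,x_k),$$ both with values in $[0,\infty]$. *)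

(* Defs.v *)
From HB Require Import structures.
From mathcomp Require Import all_boot all_order all_algebra.
From mathcomp Require Import all_classical all_reals all_analysis.

Set Implicit Arguments.
Unset Strict Implicit.
Unset Printing Implicit Defensive.

Import Order.TTheory GRing.Theory Num.Theory.
Import numFieldNormedType.Exports.

Local Open Scope classical_set_scope.
Local Open Scope ring_scope.

Section quasi_metric.
Context {R : realType} {X : Type}.

(* The triangle constant is a parameter; 1 <= kappa is assumed separately. *)
Record quasi_metric (kappa : R) (d : X -> X -> R) : Prop := QuasiMetric {
  quasi_metric_ge0 : forall x y, 0 <= d x y ;
  quasi_metric_sym : forall x y, d x y = d y x ;
  quasi_metric_eq0 : forall x y, d x y = 0 <-> x = y ;
  quasi_metric_triangle : forall x y z, d x z <= kappa * (d x y + d y z) }.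

Definition qball (d : X -> X -> R) (x : X) (r : R) : set X :=
  [set y | d x y < r].

Definition qopen (d : X -> X -> R) (U : set X) : Prop :=
  forall x, U x -> exists2 r : R, 0 < r & qball d x r `<=` U.

(* The neutral element 0 of the maximum is harmless because d is nonnegative. *)
Definition hypermetric (d : X -> X -> R) (n : nat) (xs : n.-tuple X) : R :=
  inf [set \big[Order.max/0]_(i < n) d (tnth xs i) u | u in [set: X]].

(* The set E(x, r) over which the maximal operator M averages: the centre x is
   the first entry of the hypermetric of order k+1. *)
Definition hyperball (d : X -> X -> R) (k : nat) (x : X) (r : R) :
    set (k.-tuple X) :=
  [set xs : k.-tuple X | hypermetric d [tuple of x :: xs] < r].

End quasi_metric.

Section measure.
Context {R : realType} {disp : measure_display} {X : measurableType disp}.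
Local Open Scope ereal_scope.

Definition ahlfors_regular (d : X -> X -> R) (mu : {measure set X -> \bar R})
    (alpha gamma Gamma : R) : Prop :=
  forall (x : X) (r : R), (0 < r)%R ->
    (gamma * r `^ alpha)%:E <= mu (qball d x r) <= (Gamma * r `^ alpha)%:E.

(* The product measure mu^n on X^n, iterating the binary product along the
   identification X^(n+1) = X * X^n; on X^0 it is the unit mass. *)
Fixpoint power_measure (mu : set X -> \bar R) (n : nat) :
    set (n.-tuple X) -> \bar R :=
  match n return set (n.-tuple X) -> \bar R with
  | 0%N => \d_[tuple]
  | m.+1 => pushforward (mu \x @power_measure mu m)
              (fun p : X * m.-tuple X => [tuple of p.1 :: p.2])
  end.

End measure.

Section maximal.
Context {R : realType} {disp : measure_display} {X : measurableType disp}.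
Variables (d : X -> X -> R) (mu : {measure set X -> \bar R}) (k : nat).
Local Open Scope ereal_scope.

Let muk : set (k.-tuple X) -> \bar R := @power_measure R disp X mu k.

Definition normalizer (phi : R -> R) (x : X) (eps : R) : \bar R :=
  \int[muk]_xs (phi (hypermetric d [tuple of x :: xs] / eps))%:E.

(* The extended-real inverse: J(x, eps) is positive and finite whenever the
   integral of phi(t) t^(k alpha - 1) is and the space is alpha-Ahlfors regular. *)
Definition approx_kernel (phi : R -> R) (eps : R) (x : X) (xs : k.-tuple X) :
    \bar R :=
  (normalizer phi x eps)^-1
  * (phi (hypermetric d [tuple of x :: xs] / eps))%:E.

Definition abs_tensor (f : 'I_k -> X -> R) (xs : k.-tuple X) : R :=
  \prod_(i < k) `|f i (tnth xs i)|%R.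

Definition kernel_maximal (phi : R -> R) (f : 'I_k -> X -> R) (x : X) :
    \bar R :=
  ereal_sup [set \int[muk]_xs (approx_kernel phi eps x xs
                               * (abs_tensor f xs)%:E)
            | eps in [set eps : R | (0 < eps)%R]].

Definition hyper_maximal (f : 'I_k -> X -> R) (x : X) : \bar R :=
  ereal_sup [set (muk (hyperball d x r))^-1
                 * \int[muk]_(xs in hyperball d x r) (abs_tensor f xs)%:E
            | r in [set r : R | (0 < r)%R]].

End maximal.

(* Main.v *)
(* The constant C = 1 works, by the layer-cake formula. Since phi is
   nonincreasing, every superlevel set of phi(rho(x, .) / eps) is of the form
   rho < r or rho <= r, or everything, hence E(x, r) or a monotone limit of such
   sets, on each of which the integral of the tensor product is at most M(f)(x)
   times the measure. Integrating over the levels gives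
     int phi(rho / eps) prod |f_i| <= M(f)(x) J(x, eps).
   Ahlfors regularity makes X separable, so that E(x, r) is a countable union of
   boxes B(q, r)^k, hence measurable. *)
From HB Require Import structures.
Require Import Defs.
From mathcomp Require Import all_boot all_order all_algebra.
From mathcomp Require Import all_classical all_reals all_analysis.
From mathcomp Require Import measurable_realfun.

Set Implicit Arguments.
Unset Strict Implicit.
Unset Printing Implicit Defensive.

Import Order.TTheory GRing.Theory Num.Theory.
Import numFieldNormedType.Exports.

Local Open Scope classical_set_scope.
Local Open Scope ring_scope.

(** * The layer-cake formula with a weight [F] *)

Section layer_cake.
Context {disp : measure_display} {T : measurableType disp} {R : realType}.
Variable m : {sigma_finite_measure set T -> \bar R}.
Variables (g : T -> R) (F : T -> \bar R).
Hypotheses (mg : measurable_fun [set: T] g) (mF : measurable_fun [set: T] F).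
Hypotheses (g0 : forall x, 0 <= g x) (F0 : forall x, (0 <= F x)%E).

Let under : set (T * R) := [set p | 0 <= p.2 < g p.1].

Let measurable_under : measurable under.
Proof.
have m2 : measurable_fun [set: T * R] (fun p => 0 <= p.2).
  by apply: measurable_fun_ler.
have m1 : measurable_fun [set: T * R] (fun p => p.2 < g p.1).
  by apply: measurable_fun_ltr => //; exact: measurableT_comp.
have := measurable_and m2 m1.
move=> /(_ measurableT [set true] I).
by rewrite setTI.
Qed.

Let h (p : T * R) : \bar R := (F p.1 * (\1_under p)%:E)%E.

Let mh : measurable_fun [set: T * R] h.
Proof.
apply: emeasurable_funM; first exact: measurableT_comp.
by apply/measurable_EFinP; exact: measurable_indic.
Qed.

Let h0 p : (0 <= h p)%E.
Proof. by rewrite mule_ge0// lee_fin. Qed.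

(** The section of [under] at a level [s < 0] is empty, which accounts for the restriction to
    nonnegative levels. *)
Let fubini_GE s : fubini_G m h s =
  ((fun s => \int[m]_(x in [set x | (s < g x)%R]) F x)%E \_ `[0, +oo[) s.
Proof.
rewrite /fubini_G /patch.
case: ifPn; rewrite ?notin_setE ?inE/= in_itv/= andbT => s0.
  rewrite [RHS]integral_mkcond; apply: eq_integral => x _.
  rewrite /h /patch indicE.
  have -> : ((x, s) \in under) = (x \in [set x | s < g x]).
    by apply: asbool_equiv_eq; rewrite /under/= s0.
  by case: ifPn; rewrite ?mule1 ?mule0.
apply: integral0_eq => x _; rewrite /h indicE memNset ?mule0//.
by rewrite /under/= => /andP[]; move: s0 => /negP/negbTE ->.
Qed.

Lemma measurable_superlevel_integral :
  measurable_fun (`[0, +oo[%classic : set R)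
    (fun s => \int[m]_(x in [set x | (s < g x)%R]) F x)%E.
Proof.
apply/measurable_restrictT => //.
rewrite -(funext fubini_GE).
exact: measurable_fun_fubini_tonelli_G.
Qed.

(** Tonelli for [h], the weight [F] on the region under the graph of [g]: integrating in [s] first
    gives [F x] times the length of [[0, g x[], and integrating in [x] first gives the superlevel
    integrals. *)
Lemma layer_cake : (\int[m]_x ((g x)%:E * F x) =
  \int[lebesgue_measure]_(s in `[0%R, +oo[)
    \int[m]_(x in [set x | (s < g x)%R]) F x)%E.
Proof.
rewrite [RHS]integral_mkcond -(funext fubini_GE).
rewrite -fubini_tonelli2// fubini_tonelli1//.
apply: eq_integral => x _; rewrite /fubini_F /h /=.
under eq_integral => s _.
  have -> : \1_under (x, s) = \1_(`[0, g x[%classic : set R) s :> R by [].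
  over.
rewrite ge0_integralZl//; last exact/measurable_EFinP/measurable_indic.
rewrite integral_indic// setIT muleC.
congr (_ * _)%E.
apply/esym/(etrans (lebesgue_measure_itv `[0%R, g x[)) => /=; rewrite lte_fin.
have := g0 x; rewrite le_eqVlt => /predU1P[<-|->]; first by rewrite ltxx.
by rewrite oppr0 adde0.
Qed.

End layer_cake.

(** * From sublevel sets of [rho] to nonincreasing functions of [rho] *)

Section radial.
Context {disp : measure_display} {T : measurableType disp} {R : realType}.
Variables (rho : T -> R).
Hypotheses (mrho : measurable_fun [set: T] rho) (rho0 : forall x, 0 <= rho x).

Let lower (D : set R) := forall s t, 0 <= s -> s <= t -> D t -> D s.

(** As [rho] is nonnegative, only the part of [D] in [[0, +oo[] matters, and that part is an
    interval. Outside it [lower] gives no control of [D]. *)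
Lemma measurable_lower_preimage (D : set R) : lower D ->
  measurable (rho @^-1` D).
Proof.
move=> lD; rewrite (_ : _ @^-1` _ = rho @^-1` (D `&` `[0, +oo[)); last first.
  apply/seteqP; split => x /=; last by case.
  by rewrite in_itv/= rho0.
rewrite -[X in measurable X]setTI; apply: mrho => //.
apply: is_interval_measurable => s t [Ds] + [Dt] +.
rewrite /= !in_itv/= !andbT => s0 _ u /andP[su ut].
have u0 := le_trans s0 su.
by split; [exact: lD Dt|rewrite /= in_itv/= u0].
Qed.

Lemma measurable_nonincreasing_comp (phi : R -> R) :
  (forall s t, 0 <= s -> s <= t -> phi t <= phi s) ->
  measurable_fun [set: T] (phi \o rho).
Proof.
move=> phi_le; apply: (measurability _ (RGenOInfty.measurableE R)).
move=> _ [_ [a ->]] <-; rewrite setTI comp_preimage.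
apply: measurable_lower_preimage => s t s0 st /=.
by rewrite !in_itv/= !andbT => /lt_le_trans; apply; exact: phi_le.
Qed.

Variable m : {measure set T -> \bar R}.
Variable F : T -> \bar R.
Hypotheses (mF : measurable_fun [set: T] F) (F0 : forall x, (0 <= F x)%E).
Variable M : R.
Hypothesis fin_sublevel : forall r, 0 < r ->
  (m [set x | (rho x < r)%R] < +oo)%E.
Hypothesis le_sublevel : forall r, 0 < r ->
  (\int[m]_(x in [set x | (rho x < r)%R]) F x <=
    M%:E * m [set x | (rho x < r)%R])%E.

Let measurable_sublevel r : measurable [set x | rho x < r].
Proof.
apply: (measurable_lower_preimage (D := [set t | t < r])) => s t _ st /=.
exact: le_lt_trans.
Qed.

(* The cases are rho @^-1` D = everything, rho <= r, empty, and rho < r. *)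
Lemma lower_integral_le (D : set R) : lower D ->
  (\int[m]_(x in rho @^-1` D) F x <= M%:E * m (rho @^-1` D))%E.
Proof.
move=> lD; have mD := measurable_lower_preimage lD.
have [DT|] := pselect (forall t, 0 <= t -> D t).
  pose E n := [set x | rho x < n%:R].
  (* Continuity from below. The index is shifted because [le_sublevel] requires a positive
     radius. *)
  have -> : rho @^-1` D = \bigcup_n E n.+1.
    apply/seteqP; split => x /= _; last exact: DT.
    exists (Num.truncn (rho x)) => //=.
    exact: truncnS_gt.
  have ndE : nondecreasing_seq (fun n => E n.+1).
    move=> n p np; apply/subsetPset => x; rewrite /E/= => /lt_le_trans; apply.
    by rewrite ler_nat ltnS.
  have mE n : measurable (E n.+1) by exact: measurable_sublevel.
  have cI := @ge0_nondecreasing_set_cvg_integral _ _ _ _ F m ndE mE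
    (fun i => measurable_funTS mF) (fun i x _ => F0 x).
  have cm : (m (E n.+1) @[n --> \oo] --> m (\bigcup_n E n.+1))%E.
    by apply: nondecreasing_cvg_mu => //; exact: bigcup_measurable.
  apply: (lee_cvg_to cI (cvgeZl _ cm)) => //; apply: nearW => n.
  exact: le_sublevel.
move=> /existsNP[b /not_implyP[b0 Db]].
have Dub t : 0 <= t -> D t -> t <= b.
  move=> t0 Dt; rewrite leNgt; apply/negP => /ltW bt.
  exact/Db/(lD _ _ b0 bt).
have [[r [r0 Dr rmax]]|nomax] :=
    pselect (exists r, [/\ 0 <= r, D r & forall t, 0 <= t -> D t -> t <= r]).
  (* Here the preimage is the closed sublevel set [rho <= r], approached from outside; continuity
     from above rests on [fin_sublevel]. *)
  pose E n := [set x | rho x < r + n.+1%:R^-1].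
  have rn0 n : 0 < r + n.+1%:R^-1 by rewrite ltr_wpDl.
  have DE : rho @^-1` D = \bigcap_n E n.
    apply/seteqP; split => x /=.
      by move=> Dx n _; rewrite /E/= ltr_pwDr ?rmax.
    move=> Ex; apply: (lD _ r) => //; apply/ler_addgt0Pr => e e0.
    have [n ne] : exists n, n.+1%:R^-1 < e.
      exists (Num.truncn e^-1); rewrite invf_plt ?posrE//.
      exact: truncnS_gt.
    by apply/ltW/(lt_trans (Ex n I)); rewrite ltrD2l.
  have cm : (m (E n) @[n --> \oo] --> m (\bigcap_n E n))%E.
    apply: nonincreasing_cvg_mu.
    - exact: fin_sublevel.
    - by move=> n; exact: measurable_sublevel.
    - by rewrite -DE.
    move=> n p np; apply/subsetPset => x; rewrite /E/= => /lt_le_trans; apply.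
    by rewrite lerD2l lef_pV2 ?posrE// ler_nat ltnS.
  (* The limit is taken on the measure side only: the integral over [D] is below the one over each
     [E n] by monotonicity, so [F] need not be integrable. *)
  have := cvgeZl (erefl : M%:E \is a fin_num) cm; rewrite -DE => cMm.
  apply: (cvge_to_ge cMm); apply: nearW => n.
  apply: le_trans (le_sublevel (rn0 n)); apply: ge0_subset_integral => //.
    exact: measurable_funTS.
  by rewrite DE; apply: bigcap_inf.
have [[t [t0 Dt]]|D0] := pselect (exists t, 0 <= t /\ D t); last first.
  rewrite (_ : _ @^-1` _ = set0) ?integral_set0 ?measure0 ?mule0//.
  by apply/seteqP; split => // x /= Dx; apply: D0; exists (rho x).
(* [D'] is nonempty, bounded by [b] and has no maximum, so it is [[0, sup D'[]. *)
pose D' := D `&` [set t | 0 <= t].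
have supD' : has_sup D'.
  by split; [exists t|exists b => u [Du u0]; exact: Dub].
have subD' u : D' u -> u < sup D'.
  move=> D'u; rewrite lt_neqAle (ub_le_sup supD'.2)// andbT.
  apply/eqP => uE; apply: nomax; exists u; split; [exact: D'u.2|exact: D'u.1|].
  by move=> v v0 Dv; rewrite uE (ub_le_sup supD'.2).
have -> : rho @^-1` D = [set x | rho x < sup D'].
  apply/seteqP; split => x /=.
    by move=> Dx; apply: subD'; split; last exact: rho0.
  move=> /(sup_gt supD'.1)[u [Du _] /ltW xu].
  exact: lD Du.
by apply: le_sublevel; exact: le_lt_trans t0 (subD' _ (conj Dt t0)).
Qed.

End radial.

(** The layer-cake formula is applied with weight [F] on the left and weight 1 on the right; the two
    integrands are then compared level by level, each level set being the preimage of a lower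
    set. *)
Lemma nonincreasing_integral_le {disp : measure_display}
    {T : measurableType disp} {R : realType}
    (m : {sigma_finite_measure set T -> \bar R}) (rho : T -> R)
    (F : T -> \bar R) (M : R) (phi : R -> R) :
  measurable_fun [set: T] rho -> (forall x, 0 <= rho x) ->
  measurable_fun [set: T] F -> (forall x, (0 <= F x)%E) -> 0 <= M ->
  (forall r, 0 < r -> (m [set x | (rho x < r)%R] < +oo)%E) ->
  (forall r, 0 < r -> (\int[m]_(x in [set x | (rho x < r)%R]) F x <=
    M%:E * m [set x | (rho x < r)%R])%E) ->
  (forall t, 0 <= t -> 0 <= phi t) ->
  (forall s t, 0 <= s -> s <= t -> phi t <= phi s) ->
  (\int[m]_x ((phi (rho x))%:E * F x) <= M%:E * \int[m]_x (phi (rho x))%:E)%E.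
Proof.
move=> mrho rho0 mF F0 M0 finm leM phi0 phi_le.
have mg := measurable_nonincreasing_comp mrho rho0 phi_le.
have g0 x : 0 <= phi (rho x) by exact: phi0.
have m1 : measurable_fun [set: T] (cst 1%E : T -> \bar R) by [].
have -> : (\int[m]_x (phi (rho x))%:E =
    \int[m]_x ((phi (rho x))%:E * cst 1 x))%E.
  by apply: eq_integral => x _; rewrite mule1.
have one0 x : (0 <= (cst 1 : T -> \bar R) x)%E by exact: lee01.
rewrite (layer_cake m mg mF g0 F0) (layer_cake m mg m1 g0 one0).
have mIF := measurable_superlevel_integral m mg mF F0.
have mI1 := measurable_superlevel_integral m mg m1 one0.
rewrite -ge0_integralZl//; last by move=> s _; exact: integral_ge0.
apply: ge0_le_integral => //.
- by move=> s _; exact: integral_ge0.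
- exact: measurable_funeM.
move=> s _.
have lD : forall t u, 0 <= t -> t <= u -> s < phi u -> s < phi t.
  by move=> t u t0 tu /lt_le_trans; apply; exact: phi_le.
rewrite integral_cst ?mul1e; last first.
  exact: (measurable_lower_preimage mrho rho0 (D := [set t | s < phi t])).
exact: (lower_integral_le (m := m) mrho rho0 mF F0 finm leM
  (D := [set t | s < phi t])).
Qed.

(** * Boxes and powers of a sigma-finite measure *)

Definition tuple_box {X : Type} (n : nat) (A : set X) : set (n.-tuple X) :=
  [set xs | forall i, A (tnth xs i)].

Lemma measurable_tuple_box {disp : measure_display} {X : measurableType disp}
  (n : nat) (A : set X) : measurable A -> measurable (@tuple_box X n A).
Proof.
move=> mA.
rewrite (_ : tuple_box _ =
    \bigcap_(i in [set: 'I_n]) ((@tnth n X)^~ i @^-1` A)).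
  apply: fin_bigcap_measurable => // i _.
  rewrite -[X in measurable X]setTI; exact: measurable_tnth.
by apply/seteqP; split => xs /= => [h i _|h i]; exact: h.
Qed.

(** Turns a proof of sigma-finiteness into a bundled structure on the same set function, as
    Tonelli's theorem requires. *)
Lemma sigma_finite_measureE {disp : measure_display} {X : measurableType disp}
    {R : realType} (m : {measure set X -> \bar R}) : sigma_finite [set: X] m ->
  exists m' : {sigma_finite_measure set X -> \bar R},
    (m' : set X -> \bar R) = m.
Proof.
move=> mfin.
pose s1 := isSFinite.Build _ _ _ _ (sfinite_measure_sigma_finite mfin).
pose s2 := isSigmaFinite.Build _ _ _ _ mfin.
pose m' : {sigma_finite_measure set X -> \bar R} :=
  HB.pack (Measure.sort m) s1 s2.
by exists m'.
Qed.

(** Finiteness on boxes is carried through the induction: it gives sigma-finiteness of the next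
    power, and later the finiteness of the measure of [hyperball]. *)
Lemma power_measure_sigma_finite {R : realType} {disp : measure_display}
    {X : measurableType disp} (mu : {sigma_finite_measure set X -> \bar R})
    (n : nat) :
  exists2 m : {sigma_finite_measure set (n.-tuple X) -> \bar R},
    (m : set (n.-tuple X) -> \bar R) = @power_measure R disp X mu n &
    forall A : set X, measurable A -> (mu A < +oo)%E ->
      (m (tuple_box A) < +oo)%E.
Proof.
elim: n => [|n [m mE mfin]].
  exists (\d_([tuple] : 0.-tuple X)) => // A _ _.
  by rewrite /= diracE; case: (_ \in _); rewrite ltry.
pose cons (p : X * n.-tuple X) : n.+1.-tuple X := [tuple of p.1 :: p.2].
have mcons : measurable_fun [set: X * n.-tuple X] cons.
  exact: measurable_cons.
have [m' m'E] : exists m' : {measure set (n.+1.-tuple X) -> \bar R},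
    (m' : set _ -> \bar R) = pushforward (mu \x m)%E cons.
  by unshelve eexists
    [the {measure set _ -> \bar R} of pushforward (mu \x m)%E cons].
have m'fin A : measurable A -> (mu A < +oo)%E -> (m' (tuple_box A) < +oo)%E.
  move=> mA Afin; rewrite m'E /pushforward.
  rewrite (_ : _ @^-1` _ = A `*` tuple_box A).
    rewrite product_measure1E//; last exact: measurable_tuple_box.
    by rewrite lte_mul_pinfty ?mfin// ge0_fin_numE.
  apply/seteqP; split => -[x xs] /=.
    move=> h; split; first exact: (h ord0).
    by move=> i; have := h (lift ord0 i); rewrite tnthS.
  move=> [Ax h] i; case: (unliftP ord0 i) => [j|] -> //.
  by rewrite tnthS; exact: h.
have [m1 m1E] :
  exists m1 : {sigma_finite_measure set (n.+1.-tuple X) -> \bar R},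
    (m1 : set _ -> \bar R) = m'.
  apply: sigma_finite_measureE.
  have /sigma_finiteP[F [TF ndF Foo]] := sigma_finiteT mu.
  exists (fun i => tuple_box (F i)) => [|i]; last first.
    have [? ?] := Foo i.
    by split; [exact: measurable_tuple_box|exact: m'fin].
  apply/esym/seteqP; split => // xs _.
  have /choice[N NP] : forall i, exists N, F N (tnth xs i).
    move=> i; have : [set: X] (tnth xs i) by [].
    by rewrite TF => -[N _]; exists N.
  (* The exhaustion [F] is nondecreasing, so the largest of the indices serves all coordinates. *)
  exists (\max_i N i)%N => // i.
  have := NP i; apply/subsetPset/ndF; exact: leq_bigmax.
exists m1; first by rewrite m1E m'E mE.
by rewrite m1E.
Qed.

(** * Separability of Ahlfors regular spaces and measurability of [hyperball] *)

Section ahlfors.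
Context {R : realType} {disp : measure_display} {X : measurableType disp}.
Variables (d : X -> X -> R) (mu : {measure set X -> \bar R}).
Variables (alpha kappa gamma Gamma : R).
Hypotheses (kappa_ge1 : 1 <= kappa) (gamma_gt0 : 0 < gamma).
Hypotheses (dP : quasi_metric kappa d).
Hypothesis mball : forall (x : X) (r : R), 0 < r -> measurable (qball d x r).
Hypothesis oball : forall (x : X) (r : R), 0 < r -> qopen d (qball d x r).
Hypothesis reg : ahlfors_regular d mu alpha gamma Gamma.

Let d0 := quasi_metric_ge0 dP.
Let dC := quasi_metric_sym dP.
Let dT := quasi_metric_triangle dP.
Let kappa_gt0 : 0 < kappa. Proof. exact: lt_le_trans kappa_ge1. Qed.

Lemma ahlfors_qball_fin x r : 0 < r -> (mu (qball d x r) < +oo)%E.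
Proof.
by move=> r0; have /andP[_ /le_lt_trans] := reg x r0; apply; rewrite ltry.
Qed.

Lemma ahlfors_sigma_finite (x : X) : sigma_finite [set: X] mu.
Proof.
exists (fun n => qball d x n.+1%:R) => [|n]; last first.
  by split; [exact: mball|exact: ahlfors_qball_fin].
apply/esym/seteqP; split => // y _; exists (Num.truncn (d x y)) => //.
exact: truncnS_gt.
Qed.

(** The radius [e / (2 * kappa)] makes the balls disjoint: a common point of two of them would put
    their centres at distance less than [e]. *)
Lemma separated_measure_ge (e : R) (s : seq X) : 0 < e ->
  pairwise (fun y z => e <= d y z) s ->
  ((gamma * (e / (2 * kappa)) `^ alpha *+ size s)%:E <=
   mu (\big[setU/set0]_(y <- s) qball d y (e / (2 * kappa))))%E.
Proof.
move=> e0; set c := e / (2 * kappa).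
have c0 : 0 < c by rewrite divr_gt0// mulr_gt0.
elim: s => [_|y s IH /= /andP[/allP ys /IH{}IH]].
  by rewrite big_nil measure0.
rewrite big_cons measureU; last 3 first.
- exact: mball.
- by apply: bigsetU_measurable => z _; exact: mball.
- apply/seteqP; split => // u [yu]; rewrite -bigcup_seq => -[z /= zs zu].
  have := ys z zs; rewrite leNgt => /negP; apply.
  apply: le_lt_trans (dT y u z) _.
  rewrite mulrC -ltr_pdivlMr// [e / _](_ : _ = c + c); last first.
    by rewrite /c invfM mulrA mulrAC -splitr.
  by rewrite ltrD// dC.
by rewrite mulrS EFinD leeD//; have /andP[] := reg y c0.
Qed.

(** Without a finite net, points could be added forever to an [e]-separated family in the ball. The
    disjoint small balls around them all lie in one ball of finite measure, which bounds their
    number. *)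
Lemma ahlfors_totally_bounded (x : X) (r e : R) : 0 < r -> 0 < e ->
  exists s : seq X, forall y, d x y < r -> exists2 z, z \in s & d z y < e.
Proof.
move=> r0 e0; pose c := e / (2 * kappa).
have c0 : 0 < c by rewrite divr_gt0// mulr_gt0.
have [//|nocover] := pselect (exists s : seq X,
  forall y, d x y < r -> exists2 z, z \in s & d z y < e).
have sep n : exists s : seq X, [/\ size s = n,
    forall y, y \in s -> d x y < r & pairwise (fun y z => e <= d y z) s].
  elim: n => [|n [s [sn sr sp]]]; first by exists [::].
  have /existsNP[y /not_implyP[xy ys]] :
    ~ forall y, d x y < r -> exists2 z, z \in s & d z y < e.
    by move=> h; apply: nocover; exists s.
  exists (y :: s); split => /=; first by rewrite sn.
    by move=> z; rewrite inE => /predU1P[->//|]; exact: sr.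
  rewrite sp andbT; apply/allP => z zs; rewrite leNgt; apply/negP => yz.
  by apply: ys; exists z => //; rewrite dC.
(* By the triangle inequality, the ball of radius [K] around [x] contains the ball of radius [c]
   around each point of the family; [v] is the lower bound for the measure of each small ball. *)
pose K := kappa * (r + c).
have K0 : 0 < K by rewrite mulr_gt0// addr_gt0.
pose v := gamma * c `^ alpha.
have v0 : 0 < v by rewrite mulr_gt0// powR_gt0.
have [s [sn sr sp]] := sep (Num.truncn (Gamma * K `^ alpha / v)).+1.
have : ((v *+ size s)%:E <= (Gamma * K `^ alpha)%:E)%E.
  have /andP[_] := reg x K0; apply: le_trans.
  apply: le_trans (separated_measure_ge e0 sp) _.
  apply: le_measure; rewrite ?inE.
  - by apply: bigsetU_measurable => z _; exact: mball.
  - exact: mball.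
  - rewrite -bigcup_seq => u [z /= zs zu].
    apply: le_lt_trans (dT x z u) _.
    by rewrite ltr_pM2l// ltrD// sr.
rewrite lee_fin sn -mulr_natl -ler_pdivlMr// leNgt => /negP[].
exact: truncnS_gt.
Qed.

Lemma ahlfors_separable (x : X) : exists q : nat -> X,
  forall y e, 0 < e -> exists n, d (q n) y < e.
Proof.
have /choice[s sP] : forall p : nat * nat, exists s : seq X, forall y,
    d x y < p.1.+1%:R -> exists2 z, z \in s & d z y < p.2.+1%:R^-1.
  by move=> p; apply: ahlfors_totally_bounded.
(* The sequence enumerates all the finite nets; [x] is the value at codes that fail to decode and at
   indices past the end of a net. *)
exists (fun n => if unpickle n is Some (p, i) then nth x (s p) i else x).
move=> y e e0; pose p := (Num.truncn (d x y), Num.truncn e^-1).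
have [z zs zy] := sP p y (truncnS_gt _).
exists (pickle (p, index z (s p))); rewrite pickleK nth_index//.
by apply: lt_trans zy _; rewrite invf_plt ?posrE//; exact: truncnS_gt.
Qed.

Let bigmax_dist_ge0 (n : nat) (xs : n.-tuple X) (u : X) :
  0 <= \big[Order.max/0]_(i < n) d (tnth xs i) u.
Proof.
by apply: (big_ind (fun z => 0 <= z)) => // a b a0 b0; rewrite le_max a0.
Qed.

(** An infimum below [r] has an element below [r]. The point [x] makes the set nonempty, and [r0]
    handles the neutral element 0 of the maximum. *)
Lemma hypermetric_ltP (n : nat) (xs : n.-tuple X) r (r0 : 0 < r) (x : X) :
  hypermetric d xs < r <-> exists u, forall i, d (tnth xs i) u < r.
Proof.
rewrite /hypermetric; set S := [set _ | _ in _].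
have S0 : lbound S 0 by move=> _ [u _ <-].
split.
  move=> /inf_lt[]; first by eexists; exists x.
  move=> _ [u _ <-] /bigmax_ltP[_ h]; exists u => i; exact: h.
move=> [u h].
apply: (@le_lt_trans _ _ (\big[Order.max/0]_(i < n) d (tnth xs i) u)).
  by apply: ge_inf; [exists 0|exists u].
by apply/bigmax_ltP; split.
Qed.

Lemma hypermetric_ge0 (n : nat) (xs : n.-tuple X) (x : X) :
  0 <= hypermetric d xs.
Proof.
apply: lb_le_inf; first by eexists; exists x.
by move=> _ [u _ <-].
Qed.

Lemma hyperballP (k : nat) (x : X) (xs : k.-tuple X) (r : R) : 0 < r ->
  hyperball d x r xs <-> exists2 u, d x u < r & forall i, d (tnth xs i) u < r.
Proof.
move=> r0; rewrite /hyperball/=; split.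
  move=> /(hypermetric_ltP _ r0 x)[u h]; exists u; first exact: (h ord0).
  by move=> i; have := h (lift ord0 i); rewrite tnthS.
move=> [u xu h]; apply/(hypermetric_ltP _ r0 x); exists u => i.
by case: (unliftP ord0 i) => [j|] -> //; rewrite tnthS.
Qed.

(* The admissible centres u form an open set, so they may be taken in a dense
   sequence. *)
Lemma measurable_hyperball (k : nat) (x : X) (r : R) : 0 < r ->
  measurable (hyperball d x r : set (k.-tuple X)).
Proof.
move=> r0; have [q dq] := ahlfors_separable x.
rewrite (_ : hyperball d x r =
    \bigcup_(n in [set n | qball d x r (q n)]) tuple_box (qball d (q n) r)).
  by apply: bigcup_measurable => n _; apply: measurable_tuple_box; exact: mball.
apply/seteqP; split => xs; last first.
  move=> [n /= xq h]; apply/hyperballP => //; exists (q n) => // i.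
  by rewrite dC; exact: h.
move=> /(hyperballP _ _ r0)[u xu h].
have [e e0 eP] := oball r0 xu.
have /choice[f fP] : forall i, exists f, 0 < f /\
    qball d u f `<=` qball d (tnth xs i) r.
  by move=> i; have [f f0 fP] := oball r0 (h i); exists f.
(* A radius good for [x] and all entries at once, so that a single point of the dense sequence
   replaces [u]. *)
pose g := \big[Order.min/e]_(i < k) f i.
have g0 : 0 < g by apply/bigmin_gtP; split => // i _; exact: (fP i).1.
have [n qu] := dq u g g0; rewrite dC in qu.
exists n.
  by apply/eP/(lt_le_trans qu); exact: bigmin_le_id.
move=> i; rewrite /qball/= dC.
by apply/(fP i).2/(lt_le_trans qu)/bigmin_le_cond.
Qed.

(** Each entry is linked to [x] through the common centre [u]. The inclusion serves to bound the
    measure of [hyperball]. *)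
Lemma hyperball_sub_box (k : nat) (x : X) (r : R) : 0 < r ->
  (hyperball d x r : set (k.-tuple X)) `<=`
    tuple_box (qball d x (kappa * (r + r))).
Proof.
move=> r0 xs /(hyperballP _ _ r0)[u xu h] i.
apply: le_lt_trans (dT x u _) _.
by rewrite ltr_pM2l// ltrD// dC.
Qed.

End ahlfors.

(** * The pointwise bound between the maximal operators *)

Lemma measurable_abs_tensor {R : realType} {disp : measure_display}
    {X : measurableType disp} (k : nat) (f : 'I_k -> X -> R) :
  (forall i : 'I_k, measurable_fun [set: X] (f i)) ->
  measurable_fun [set: k.-tuple X] (abs_tensor f).
Proof.
move=> mf; apply: measurable_prod => i _.
apply: measurableT_comp => //; apply: (measurableT_comp (mf i)).
exact: measurable_tnth.
Qed.

(* If J = 0, its inverse is +oo, but N <= M J forces N = 0 unless M = +oo, and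
   the product vanishes; if J = +oo, its inverse is 0. *)
Lemma lee_invM {R : realType} (J M N : \bar R) :
  (0 <= J -> 0 <= M -> 0 <= N -> N <= M * J -> J^-1 * N <= M)%E.
Proof.
move: J M => [j| |] [M| |] //=; rewrite ?leey// ?invey ?mul0e//.
rewrite lee_fin => j0 M0 N0; have [->|jn0] := eqVneq j 0.
  rewrite mule0 => Nle0; have -> : N = 0%E by apply/eqP; rewrite eq_le Nle0.
  by rewrite mule0.
have jp : 0 < j by rewrite lt0r jn0.
by rewrite inver (negbTE jn0)/= muleC lee_pdivrMl.
Qed.

Theorem theorem3p2 (R : realType) (alpha kappa gamma Gamma : R) (k : nat)
    (alpha_gt0 : 0 < alpha) (kappa_ge1 : 1 <= kappa)
    (gamma_gt0 : 0 < gamma) (gamma_le_Gamma : gamma <= Gamma)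
    (k_gt0 : (0 < k)%N) :
  exists C : R,
    forall (disp : measure_display) (X : measurableType disp)
      (d : X -> X -> R) (mu : {measure set X -> \bar R}) (phi : R -> R),
    quasi_metric kappa d ->
    (forall (x : X) (r : R), 0 < r -> measurable (qball d x r)) ->
    (forall (x : X) (r : R), 0 < r -> qopen d (qball d x r)) ->
    ahlfors_regular d mu alpha gamma Gamma ->
    (forall t : R, 0 <= t -> 0 <= phi t) ->
    (forall s t : R, 0 <= s -> s <= t -> phi t <= phi s) ->
    (0 < \int[lebesgue_measure]_(t in `]0%R, +oo[)
           (phi t * t `^ (k%:R * alpha - 1))%:E < +oo)%E ->
    forall f : 'I_k -> X -> R,
    (forall i : 'I_k, measurable_fun [set: X] (f i)) ->
    forall x : X,
    (kernel_maximal d mu phi f x <= C%:E * hyper_maximal d mu f x)%E.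
Proof.
exists 1 => disp X d mu phi dP mball oball reg phi0 phi_le _ f mf x.
rewrite mul1e.
have [mu' mu'E] := sigma_finite_measureE (ahlfors_sigma_finite mball reg x).
have [m mE mfin] := power_measure_sigma_finite mu' k.
rewrite mu'E in mE mfin.
rewrite /kernel_maximal /approx_kernel /normalizer /hyper_maximal -mE.
pose F xs := (abs_tensor f xs)%:E.
have mF : measurable_fun [set: k.-tuple X] F.
  by apply/measurable_EFinP; exact: measurable_abs_tensor.
have F0 xs : (0 <= F xs)%E by rewrite lee_fin prodr_ge0.
pose rho (xs : k.-tuple X) := hypermetric d [tuple of x :: xs].
have rho0 xs : 0 <= rho xs by exact: (hypermetric_ge0 dP [tuple of x :: xs] x).
have mE0 r : 0 < r -> measurable (hyperball d x r : set (k.-tuple X)).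
  move=> r0.
  exact: (measurable_hyperball kappa_ge1 gamma_gt0 dP mball oball reg x r0).
have mrho : measurable_fun [set: k.-tuple X] rho.
  apply: (measurability _ (RGenInftyO.measurableE R)).
  move=> _ [_ [a ->]] <-; rewrite setTI.
  (* The preimage of the ray below [a] is a [hyperball] if [a] is positive, and empty otherwise. *)
  have [a0|a0] := ltP 0 a.
    rewrite (_ : _ @^-1` _ = hyperball d x a); first exact: mE0.
    by apply/seteqP; split => xs /=; rewrite in_itv.
  rewrite (_ : _ @^-1` _ = set0)//.
  apply/seteqP; split => // xs /=; rewrite in_itv/= ltNge => /negP; apply.
  exact: le_trans (rho0 xs).
have finE r : 0 < r -> (m (hyperball d x r) < +oo)%E.
  move=> r0; have kr0 : 0 < kappa * (r + r).
    by rewrite mulr_gt0 ?addr_gt0// (lt_le_trans _ kappa_ge1).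
  apply: le_lt_trans (mfin _ (mball x _ kr0) (ahlfors_qball_fin reg x kr0)).
  apply: le_measure; rewrite ?inE.
  - exact: mE0.
  - by apply: measurable_tuple_box; exact: mball.
  - exact: (hyperball_sub_box kappa_ge1 dP r0).
set M := (X in (_ <= X)%E).
have M0 : (0 <= M)%E.
  apply: le_trans (_ : (m (hyperball d x 1))^-1 *
    \int[m]_(xs in hyperball d x 1) F xs <= M)%E.
    by rewrite mule_ge0 ?inve_ge0 ?integral_ge0.
  by apply: ereal_sup_ubound; exists 1 => //=; exact: ltr01.
apply: ge_ereal_sup => _ [eps /= eps0 <-].
have [->|Moo] := eqVneq M +oo%E; first by rewrite leey.
have Mfin : M \is a fin_num by rewrite ge0_fin_numE// ltey.
have leM r : 0 < r -> (\int[m]_(xs in hyperball d x r) F xs <=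
    (fine M)%:E * m (hyperball d x r))%E.
  move=> r0; rewrite fineK//.
  have : ((m (hyperball d x r))^-1 *
      \int[m]_(xs in hyperball d x r) F xs <= M)%E.
    by apply: ereal_sup_ubound; exists r.
  have mFE : measurable_fun (hyperball d x r) F by exact: measurable_funTS.
  (* On a null set one cannot multiply the bound on the average by the measure, but the integral
     vanishes there. *)
  have [E0|E0] := eqVneq (m (hyperball d x r)) 0%E.
    by rewrite (null_set_integral (mE0 _ r0) mFE E0) E0 !mule0 lexx.
  have mE1 : m (hyperball d x r) \is a fin_num by rewrite ge0_fin_numE ?finE.
  have mE2 : 0 < fine (m (hyperball d x r)).
    by rewrite fine_gt0// lt0e E0 measure_ge0 finE.
  by rewrite -(fineK mE1) inver gt_eqF//= lee_pdivrMl// muleC.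
pose psi t := phi (t / eps).
under eq_integral do rewrite -muleA.
have psi_le s t : 0 <= s -> s <= t -> psi t <= psi s.
  by move=> s0 st; apply: phi_le; rewrite ?ler_pM2r ?invr_gt0// divr_ge0// ltW.
have mpsi : measurable_fun [set: k.-tuple X] (psi \o rho).
  exact: measurable_nonincreasing_comp.
have psi_ge0 t : 0 <= t -> 0 <= psi t.
  by move=> t0; apply/phi0/divr_ge0 => //; exact: ltW.
have psi0 xs : 0 <= psi (rho xs) by exact: psi_ge0.
have J0 : (0 <= \int[m]_xs (psi (rho xs))%:E)%E.
  by apply: integral_ge0 => xs _; rewrite lee_fin.
have N0 : (0 <= \int[m]_xs ((psi (rho xs))%:E * F xs))%E.
  by apply: integral_ge0 => xs _; apply: mule_ge0 => //; rewrite lee_fin.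
rewrite ge0_integralZl ?inve_ge0//; last 2 first.
- by apply: emeasurable_funM => //; apply/measurable_EFinP.
- by move=> xs _; apply: mule_ge0; [rewrite lee_fin; exact: psi0|exact: F0].
(* What remains is the bound of the unnormalized integral by [M] times the normalizer, with [M] made
   real. *)
apply: lee_invM => //; rewrite -(fineK Mfin).
apply: (nonincreasing_integral_le (rho := rho) (phi := psi)) => //.
exact: fine_ge0.
Qed.
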